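(* Let $(\Omega,\mathcal{F})$ be a measurable space, let $C$ be a nonempty closed convex bounded separable subset of a finite dimensional Banach space $X$, and let $T:\Omega\times C\to 2^{C}$ be a random operator which satisfies condition $\mathcal{M}$. Suppose that, for each $\omega\in\Omega$, $T(\omega,\cdot)$ is almost lower semicontinuous and 1-set-contractive, with nonempty, convex and closed values, and that the inverse $(T(\omega,\cdot))^{-1}$ on $C$ is closed valued, i.e. $\{x\in C: y\in T(\omega,x)\}$ is closed for every $y\in C$. Then $T$ has a random fixed point.
   Context: $2^{D}$ denotes the set of all nonempty subsets of $D$. For $B_0\subseteq X$ and $r>0$, $B(B_0,r)=\{y\in X: d(y,B_0)<r\}$, where $d(y,B_0)=\inf_{x\in B_0}\|y-x\|$. For $F:C\to 2^{X}$ and $A\subseteq C$, $F(A)=\bigcup_{x\in A}F(x)$. Random operator: $T:\Omega\times C\to 2^{C}$ is a random operator if for each $x\in C$, $T(\cdot,x)$ is (lower) measurable, i.e. $\{\omega\in\Omega: T(\omega,x)\cap V\neq\emptyset\}\in\mathcal{F}$ for every $V$ open in $C$. Almost lower semicontinuous: $F:C\to 2^{X}$ is almost lower semicontinuous if for each $x\in C$ and each $\varepsilon>0$ there is a neighborhood $U(x)$ of $x$ in $C$ such that $\bigcap_{z\in U(x)}B(F(z),\varepsilon)\neq\emptyset$. (A correspondence into $C$ is regarded as one into $X$.) 1-set-contractive: $\gamma$ is the Kuratowski measure of noncompactness: for bounded $A\subseteq X$, $\gamma(A)=\inf\{e>0: A$ is covered by a finite number of sets of diameter $\le e\}$, and $\gamma(A)=\infty$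 if $A$ is unbounded. $F:C\to 2^{X}$ is 1-set-contractive if $\gamma(F(A))\le\gamma(A)$ for each $A\subseteq C$ with $\gamma(A)>0$. Random fixed point of $T$: a measurable mapping $\xi:\Omega\to C$ with $\xi(\omega)\in T(\omega,\xi(\omega))$ for every $\omega\in\Omega$. Condition $\mathcal{M}$ for $T$: whenever $\eta_n,\xi_n:\Omega\to C$ ($n\in\mathbb{N}$) are measurable mappings with $\eta_n(\omega)\in T(\omega,\xi_n(\omega))$ for each $n$ and each $\omega\in\Omega$, and $\xi_n(\omega)-\eta_n(\omega)\to 0$ as $n\to\infty$ for each $\omega\in\Omega$, then there exists a random fixed point $\xi$ of $T$. *)

(* Defs.v *)
From HB Require Import structures.
From mathcomp Require Export all_boot all_order all_algebra.
From mathcomp Require Export all_classical all_reals all_analysis.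
Export Order.TTheory GRing.Theory Num.Theory numFieldNormedType.Exports.

Set Implicit Arguments.
Unset Strict Implicit.
Unset Printing Implicit Defensive.

Local Open Scope classical_set_scope.
Local Open Scope ring_scope.

Definition finite_dimensional (R : realType) (X : normedModType R) : Prop :=
  exists n, inhabited (Vector.axiom n X).

Definition separable (X : topologicalType) (A : set X) : Prop :=
  exists D : set X, [/\ countable D, D `<=` A & A `<=` closure D].

(* [edist], and hence the point-to-set distance [edist_inf] below,
   comes from the norm. *)
Lemma edist_normE (R : realType) (X : normedModType R) (x y : X) :
  edist (x, y) = `|x - y|%:E.
Proof.
apply/eqP; rewrite eq_le; apply/andP; split.
  apply/lee_addgt0Pr => e e0; rewrite -EFinD; apply: edist_fin.
    by rewrite ltr_wpDl.
  by rewrite -ball_normE /= ltrDl.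
apply: le_ereal_inf_tmp => _ [r [r0 bxy] <-].
by move: bxy; rewrite -ball_normE /= lee_fin => /ltW.
Qed.

Section correspondences.
Context {R : realType} {X : normedModType R}.
Implicit Types (A B C D : set X) (F : X -> set X).

(* A map F : C -> 2^D is a total function X -> set X of which only the values
   at the points of C matter. *)
Definition correspondence C D F : Prop :=
  forall x, C x -> F x !=set0 /\ F x `<=` D.

Definition image_set F A : set X := \bigcup_(x in A) F x.

Definition set_ball B (r : R) : set X := [set y | (edist_inf B y < r%:E)%E].

(* [within C (nbhs x)] is the filter of the sets whose trace on C is a
   neighborhood of x in C. *)
Definition almost_lsc C F : Prop :=
  forall x, C x -> forall e : R, 0 < e ->
  exists U : set X, [/\ U `<=` C, within C (nbhs x) U &
    \bigcap_(z in U) set_ball (F z) e !=set0].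

(* The empty set gets diameter -oo, which is harmless as diameters are only
   bounded above here. *)
Definition diameter A : \bar R :=
  ereal_sup [set `|x - y|%:E | x in A & y in A].

Definition kuratowski A : \bar R :=
  if `[< bounded_set A >] then
    ereal_inf (EFin @` [set e : R | 0 < e /\
      exists S : set (set X), [/\ finite_set S, A `<=` \bigcup_(B in S) B &
        forall B, S B -> (diameter B <= e%:E)%E]])
  else +oo%E.

Definition one_set_contractive C F : Prop :=
  forall A, A `<=` C -> (0 < kuratowski A)%E ->
  (kuratowski (image_set F A) <= kuratowski A)%E.

Definition closed_inverse C F : Prop :=
  forall y, C y -> closed [set x | C x /\ F x y].

End correspondences.

Section random_operators.
Context {R : realType} {X : normedModType R}.
Context {d : measure_display} {Omega : measurableType d}.
Implicit Types (C : set X) (T : Omega -> X -> set X).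

(* The relatively open subsets of C are the traces on C of the open sets. *)
Definition random_operator C T : Prop :=
  (forall w, correspondence C C (T w)) /\
  (forall x, C x -> forall U : set X, open U ->
    measurable [set w | T w x `&` (C `&` U) !=set0]).

(* Measurable maps Omega -> C, for the Borel sigma-algebra of C: it is the
   trace on C of that of X, so measurability into X is equivalent. *)
Definition measurable_map C (f : Omega -> X) : Prop :=
  (forall w, C (f w)) /\
  measurable_fun [set: Omega] (f : Omega -> g_sigma_algebraType (@open X)).

Definition random_fixed_point C T (xi : Omega -> X) : Prop :=
  measurable_map C xi /\ forall w, T w (xi w) (xi w).

Definition condition_M C T : Prop :=
  forall eta xi : nat -> Omega -> X,
    (forall n, measurable_map C (eta n)) ->
    (forall n, measurable_map C (xi n)) ->
    (forall n w, T w (xi n w) (eta n w)) ->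
    (forall w, (fun n => xi n w - eta n w) @ \oo --> (0 : X)) ->
  exists xi0, random_fixed_point C T xi0.

End random_operators.

(* Main.v *)
(* Since C is compact, finitely many points y_i of C are such that near
   any point of C some y_i is e-close to all values of F = T(w, .), uniformly
   on a ball of fixed radius. Colour a point of a fine grid on the simplex by
   such an i for the corresponding convex combination of the y_i. Scarf's
   theorem gives a small set of grid points whose colours J carry almost all of
   their mass, so that for z close to any of them, every y_i with i in J is
   e-close to F(z), and so is z, by convexity. Hence approximate fixed points
   form a set with nonempty interior in C and can be found in a fixed countable
   dense set, which makes the first such point measurable in w. The successive
   approximations of Kuratowski and Ryll-Nardzewski, started at that point, give
   a measurable selection close to it, and condition M concludes. *)
From mathcomp Require Import all_boot finmap zify ring.

Set Implicit Arguments.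
Unset Strict Implicit.
Unset Printing Implicit Defensive.

Lemma even_sum (S : finType) (P : pred S) (f : S -> nat) :
  (forall s, P s -> ~~ odd (f s)) -> ~~ odd (\sum_(s | P s) f s).
Proof.
move=> ev; apply: (big_ind (fun n => ~~ odd n)) => // m n.
by rewrite oddD => /negPf-> /negPf->.
Qed.

(** * Scarf's theorem *)

Section Scarf.
Variables (I X : finType) (r : I -> X -> nat).
Hypothesis r_inj : forall i, injective (r i).
Implicit Types (A B : {set X}) (J K : {set I}).

(** For nonempty [A]: no point lies strictly above the minimum of [A] in all the orders [r i] with
    [i] in [J] at once. *)
Definition dominant A J :=
  [forall x, exists i in J, forall a in A, r i x <= r i a].

Lemma dominantP A J :
  reflect (forall x, exists2 i, i \in J & forall a, a \in A -> r i x <= r i a)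
          (dominant A J).
Proof.
apply: (iffP forallP) => h x.
  by have /exists_inP[i iJ /forall_inP] := h x; exists i.
by have [i iJ ?] := h x; apply/exists_inP; exists i => //; apply/forall_inP.
Qed.

Lemma dominantS A B J K :
  A \subset B -> J \subset K -> dominant B J -> dominant A K.
Proof.
move=> /subsetP AB /subsetP JK /dominantP dBJ; apply/dominantP => x.
by have [i /JK iK h] := dBJ x; exists i => // a /AB; apply: h.
Qed.

Definition rank_min (x0 : X) A i := [arg min_(x < x0 in A) r i x].

Lemma rank_minP x0 A i : x0 \in A ->
  rank_min x0 A i \in A /\ forall a, a \in A -> r i (rank_min x0 A i) <= r i a.
Proof. by move=> x0A; rewrite /rank_min; case: arg_minnP. Qed.

(** Dominance at a point of [A] makes that point the minimum of [A] for some index in [J]. Hence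
    [#|A| <= #|J|], and in case of equality distinct indices have distinct minima. *)
Lemma rank_min_image x0 A J : x0 \in A -> dominant A J ->
  [set rank_min x0 A i | i in J] = A.
Proof.
move=> x0A /dominantP dAJ; apply/setP=> a; apply/imsetP/idP=> [[i _ ->]|aA].
  by have [] := rank_minP i x0A.
have [i iJ le_a] := dAJ a; exists i => //; apply: (@r_inj i).
have [mA le_m] := rank_minP i x0A.
by apply/eqP; rewrite eqn_leq le_m // le_a.
Qed.

Section Door.
Variables (A : {set X}) (J : {set I}) (x0 : X).
Hypotheses (x0A : x0 \in A) (dAJ : dominant A J) (cardJ : #|J| = #|A|.+1).

Let m := rank_min x0 A.
(** The points that defeat dominance once [k] is dropped from [J]; the largest of them in the order
    [r k] is the candidate for joining [A]. *)
Let above k := [set x | [forall l in J :\ k, r l (m l) < r l x]].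
Let top k := [set x in above k | [forall y in above k, r k y <= r k x]].

Let m_in l : m l \in A. Proof. by have [] := rank_minP l x0A. Qed.
Let m_le l a : a \in A -> r l (m l) <= r l a.
Proof. by have [_] := rank_minP l x0A; apply. Qed.

Let aboveP k x :
  reflect (forall l, l \in J -> l != k -> r l (m l) < r l x) (x \in above k).
Proof.
rewrite inE; apply: (iffP forall_inP) => h l.
  by move=> lJ lk; apply: h; rewrite !inE lk.
by rewrite !inE => /andP[lk lJ]; apply: h.
Qed.

Let dom_above k : dominant A (J :\ k) = (above k == set0).
Proof.
apply/dominantP/eqP => [dA|a0 x].
  apply/setP=> x; rewrite [RHS]inE; apply/negP => /aboveP xk.
  have [l] := dA x; rewrite !inE => /andP[lk lJ] /(_ (m l) (m_in l)).
  by rewrite leqNgt xk.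
have : x \notin above k by rewrite a0 inE.
rewrite inE negb_forall_in => /exists_inP[l lJk]; rewrite -leqNgt => le_x.
by exists l => // a /(m_le l); apply: leq_trans.
Qed.

Let card_top k : #|top k| = (above k != set0).
Proof.
have [a0|/set0Pn[x xk]] := eqVneq (above k) set0.
  by apply/eqP; rewrite cards_eq0; apply/eqP/setP=> x; rewrite inE a0 inE.
have [y yk ymax] := arg_maxnP (r k) xk.
apply/eqP/cards1P; exists y; apply/setP=> z; rewrite [LHS]inE [RHS]inE.
apply/andP/eqP => [[zk /forall_inP zmax]|->].
  apply: (@r_inj k); apply/eqP; rewrite eqn_leq zmax // andbT.
  exact: ymax.
by split=> //; apply/forall_inP => u; apply: ymax.
Qed.

Lemma door_even :
  ~~ odd (#|[set x | (x \notin A) && dominant (x |: A) J]| +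
          #|[set k in J | dominant A (J :\ k)]|).
Proof.
have mJ : m @: J = A by apply: rank_min_image.
have [i [j [iJ jJ ij mij]]] : exists i, exists j,
    [/\ i \in J, j \in J, i != j & m i = m j].
  have : ~~ [forall i in J, forall j in J, (m i == m j) ==> (i == j)].
    apply/negP => h; have : #|m @: J| = #|J|.
      apply: card_in_imset => i j iJ jJ /eqP mij; apply/eqP.
      by have /forall_inP/(_ i iJ)/forall_inP/(_ j jJ)/implyP := h; apply.
    by rewrite mJ cardJ => /eqP; rewrite ltn_eqF.
  rewrite negb_forall_in => /exists_inP[i iJ].
  rewrite negb_forall_in => /exists_inP[j jJ].
  by rewrite negb_imply => /andP[/eqP mij ij]; exists i, j.
have inj_dom B K y0 : y0 \in B -> dominant B K -> #|K| = #|B| ->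
    {in K &, injective (rank_min y0 B)}.
  by move=> yB dB cK; apply/imset_injP; rewrite rank_min_image // cK.
have setk : [set k in J | dominant A (J :\ k)] =
            [set k in [set i; j] | above k == set0].
  apply/setP=> k; rewrite !inE dom_above andbC [RHS]andbC.
  case: (boolP (_ == set0)) => //; rewrite -dom_above /= => dk.
  apply/idP/orP => [kJ|[/eqP->|/eqP->] //].
  have [|ki] := eqVneq k i; first by left.
  right; apply: contraNT ij => kj; apply/eqP.
  apply: (inj_dom _ _ _ x0A dk) mij; rewrite ?inE 1?eq_sym ?ki ?[_ == k]eq_sym ?kj //.
  by apply: succn_inj; rewrite -cardJ (cardsD1 k J) kJ.
(* As [i] and [j] share a minimum, every point of [A] is still the minimum for some index other than
   [k], and it is not strictly above itself. *)
have top_out k : k \in [set i; j] -> forall x, x \in top k -> x \notin A.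
  move=> kij x; rewrite inE => /andP[/aboveP xk _]; apply/negP.
  rewrite -mJ => /imsetP[l lJ xl].
  have [l' [l'J l'k xl']] : exists l', [/\ l' \in J, l' != k & x = m l'].
    have [lk|] := eqVneq l k; last by exists l.
    move: kij; rewrite !inE => /orP[]/eqP kE; [exists j|exists i];
      by rewrite ?jJ ?iJ kE ?[j == i]eq_sym ij xl lk kE.
  by have := xk _ l'J l'k; rewrite xl' ltnn.
(* By injectivity an added [x] is minimal for a single [k], hence strictly above the old minima for
   the other indices. If [k] were neither [i] nor [j], these two would still share a minimum in the
   enlarged set. *)
have setx : [set x | (x \notin A) && dominant (x |: A) J] = top i :|: top j.
  apply/setP=> x; rewrite [LHS]inE; apply/andP/idP => [[xA dx]|].
    have x_in : x \in x |: A by rewrite setU11.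
    have injx := inj_dom _ _ _ x_in dx; rewrite cardsU1 xA cardJ in injx.
    have {}injx := injx erefl.
    have minE l y : y \in x |: A -> (forall a, a \in x |: A -> r l y <= r l a) ->
        rank_min x (x |: A) l = y.
      move=> yA ley; apply: (@r_inj l); have [mA lem] := rank_minP l x_in.
      by apply/eqP; rewrite eqn_leq ley ?lem.
    have [k kJ lek] := dominantP _ _ dx x.
    have xk : x \in above k.
      apply/aboveP => l lJ lk; rewrite ltnNge; apply: contra lk => le_x.
      apply/eqP/injx => //; rewrite (minE k x) // (minE l x) // => a; rewrite !inE.
      by case/orP=> [/eqP->//|/(m_le l)]; apply: leq_trans.
    have xtop : x \in top k.
      rewrite inE xk; apply/forall_inP => y /aboveP yk.
      have [l lJ ley] := dominantP _ _ dx y.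
      have [<-|lk] := eqVneq l k; first exact: ley.
      have := ley (m l); rewrite leqNgt yk // !inE m_in orbT.
      by move=> /(_ isT).
    suff : k \in [set i; j].
      by rewrite in_set2 in_setU => /orP[]/eqP <-; rewrite xtop ?orbT.
    apply: contraNT ij; rewrite !inE negb_or => /andP[ki kj]; apply/eqP.
    have mk l : l \in J -> k != l -> rank_min x (x |: A) l = m l.
      move=> lJ kl; apply: minE => [|a]; first by rewrite !inE m_in orbT.
      rewrite !inE => /orP[/eqP->|/m_le //]; apply: ltnW.
      by move/aboveP: xk; apply; rewrite // eq_sym.
    by apply: injx => //; rewrite !mk.
  move=> xij; have [k kij xtop] : exists2 k, k \in [set i; j] & x \in top k.
    by case/setUP: xij; [exists i|exists j]; rewrite ?in_set2 ?eqxx ?orbT.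
  split; first exact: top_out kij _ xtop.
  move: xtop; rewrite inE => /andP[/aboveP xk /forall_inP xmax].
  apply/dominantP => y; have [yk|] := boolP (y \in above k).
    have [l lJ ley] := dominantP _ _ dAJ y.
    have lk : l = k.
      apply/eqP; apply: contraT => lk; move/aboveP: yk => /(_ l lJ lk).
      by rewrite ltnNge ley.
    exists l => // a; rewrite !inE => /orP[/eqP->|/ley//].
    by rewrite lk xmax.
  rewrite inE negb_forall_in => /exists_inP[l].
  rewrite !inE => /andP[lk lJ]; rewrite -leqNgt => ley.
  exists l => // a; rewrite !inE => /orP[/eqP->|/(m_le l)]; last exact: leq_trans.
  by apply: (leq_trans ley); apply/ltnW/xk.
have disj : top i :&: top j = set0.
  apply/setP=> x; rewrite !inE; apply/negP.
  case/andP=> /andP[/forall_inP xi _] /andP[/forall_inP xj _].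
  have [l lJ /(_ _ (m_in l))] := dominantP _ _ dAJ x; rewrite leqNgt => /negP[].
  have [li|li] := eqVneq l i; last by apply: xi; rewrite !inE li.
  by apply: xj; rewrite !inE li ij -li.
rewrite setx setk cardsU disj cards0 subn0 !card_top.
rewrite -sum1dep_card big_mkcondr big_setU1 ?inE //= big_set1.
by do 2!case: eqP.
Qed.

End Door.

(** * Colourings and the parity argument *)

Section Colouring.
Variables (c : X -> I) (i0 : I).

(** The cardinalities force each colour of [J] other than [i0] to occur exactly once on [A]. *)
Definition nearly_rainbow A J :=
  [&& i0 \in J, c @: A == J :\ i0 & #|J| == #|A|.+1].

Let nearly_rainbow_inj A J : nearly_rainbow A J -> {in A &, injective c}.
Proof.
case/and3P=> i0J /eqP cA /eqP cardJ; apply/imset_injP.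
by rewrite cA; apply/eqP/succn_inj; rewrite -cardJ (cardsD1 i0 J) i0J.
Qed.

(** The count is zero or two. If [i0] is not in [K], only [j = i0] could be added, which would give
    [c @: A = K]. Otherwise, an index [j] that can be added is the only colour of [A] outside [K],
    and the only removable point is the one coloured [j]. If no index can be added, a removable
    point shares its colour with exactly one other point, also removable. *)
Lemma room_even A K : c @: A != K ->
  ~~ odd (#|[set a in A | nearly_rainbow (A :\ a) K]| +
          #|[set j | (j \notin K) && nearly_rainbow A (j |: K)]|).
Proof.
move=> cAK; have [i0K|i0K] := boolP (i0 \in K); last first.
  rewrite [in X in X + _]eq_card0 => [|a]; last first.
    by rewrite !inE /nearly_rainbow (negPf i0K) andbF.
  rewrite [in X in _ + X]eq_card0 => [//|j]; rewrite !inE.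
  apply/negP => /andP[jK /and3P[]]; rewrite !inE (negPf i0K) orbF => /eqP i0j.
  by rewrite i0j setU1K // (negPf cAK).
set del := [set a in A | _]; set add := [set j | _].
have delP a : a \in del -> [/\ a \in A, c @: (A :\ a) = K :\ i0,
    #|K| = #|A| & {in A :\ a &, injective c}].
  rewrite inE => /andP[aA na]; have inj := nearly_rainbow_inj na.
  by case/and3P: na => _ /eqP ? /eqP ->; rewrite (cardsD1 a A) aA.
have addP j : j \in add -> [/\ j \notin K, c @: A = (j |: K) :\ i0,
    #|K| = #|A| & {in A &, injective c}].
  rewrite inE => /andP[jK nj]; have inj := nearly_rainbow_inj nj.
  by case/and3P: nj => _ /eqP ? /eqP; rewrite cardsU1 jK => -[].
have in_del a : #|K| = #|A| -> a \in A -> c @: (A :\ a) = K :\ i0 -> a \in del.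
  move=> cardK aA ca; rewrite inE aA /nearly_rainbow i0K ca eqxx cardK.
  by rewrite (cardsD1 a A) aA eqxx.
have [add0|[j jadd]] := set_0Vmem add.
  rewrite add0 cards0 addn0.
  have [->|[a adel]] := set_0Vmem del; first by rewrite cards0.
  have [aA ca cardK inja] := delP a adel.
  have cA : c @: A = c a |: (K :\ i0) by rewrite -ca -imsetU1 setD1K.
  have caK : c a \in K :\ i0.
    rewrite !inE; apply/andP; split.
      by apply: contraNneq cAK => cai0; rewrite cA cai0 setD1K.
    apply: contraT => caK; have : c a \in add; last by rewrite add0 inE.
    rewrite inE caK /nearly_rainbow !inE i0K orbT cardsU1 caK cardK eqxx andbT.
    rewrite cA /=; apply/eqP/setP => i; rewrite !inE.
    by case: (i =P c a) => [->|//]; case: eqP caK => // ->; rewrite i0K.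
  have /imsetP[a' a'A caa'] : c a \in c @: (A :\ a) by rewrite ca.
  have /andP[a'a a'A'] : (a' != a) && (a' \in A) by move: a'A; rewrite !inE.
  suff -> : del = [set a; a'] by rewrite cards2 eq_sym a'a.
  apply/setP => b; rewrite !in_set2; apply/idP/orP => [bdel|[]/eqP-> //].
    have [bA cb _ injb] := delP b bdel.
    have [|ba] := eqVneq b a; first by left.
    right; apply: contraT => ba'.
    have: a = a'; last by move/eqP; rewrite eq_sym (negPf a'a).
    by apply: injb => //; rewrite !inE 1?[_ == b]eq_sym ?ba ?ba'.
  apply: in_del => //; rewrite -ca; apply/setP => i.
  apply/imsetP/imsetP => -[e]; rewrite !inE => /andP[ea eA] ->.
    have [->|ea'] := eqVneq e a; first by exists a'; rewrite // !inE a'a a'A'.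
    by exists e; rewrite // !inE ea' eA.
  have [->|ea'] := eqVneq e a'; first by exists a; rewrite // !inE eq_sym a'a aA.
  by exists e; rewrite // !inE ea' eA.
have [jK cA cardK inj] := addP j jadd.
have ji0 : j != i0 by apply: contraNneq jK => ->.
have jcA : j \in c @: A by rewrite cA !inE eqxx ji0.
have /imsetP[a aA jca] := jcA.
have -> : add = [set j].
  apply/setP => k; rewrite in_set1; apply/idP/eqP => [/addP[kK cA' _ _]|->//].
  by move: jcA; rewrite cA' !inE (negPf jK) orbF ji0 => /eqP.
have -> : del = [set a].
  apply/setP => b; rewrite in_set1; apply/idP/eqP => [bdel|->].
    have [bA cb _ _] := delP b bdel.
    apply/esym/eqP; apply: contraNT jK => ab.
    have : j \in c @: (A :\ b) by rewrite jca imset_f // !inE ab.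
    by rewrite cb !inE => /andP[].
  apply: in_del => //; apply/setP => i.
  apply/imsetP/idP => [[e]|iK].
    rewrite !inE => /andP[ea eA] ->.
    have : c e \in c @: A by rewrite imset_f.
    rewrite cA !inE => /andP[-> /orP[|//]] /=.
    by rewrite jca => /eqP /inj ea'; rewrite ea' ?eqxx // in ea.
  have : i \in c @: A by move: iK; rewrite cA !inE => /andP[-> ->]; rewrite orbT.
  case/imsetP => e eA ie; exists e => //; rewrite !inE eA andbT.
  apply: contraNneq jK => ea; rewrite jca -ea -ie.
  by move: iK; rewrite !inE => /andP[].
by rewrite !cards1.
Qed.

(** Double counting of the pairs of sets differing by one element. Applied to points and to indices,
    it turns a sum over doors into a sum over rooms. *)
Lemma sum_card_setU1 (S : finType) (P : {set S} -> {set S} -> bool) :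
  \sum_(B : {set S}) #|[set x | (x \notin B) && P B (x |: B)]| =
  \sum_(B : {set S}) #|[set x in B | P (B :\ x) B]|.
Proof.
under eq_bigr do rewrite -sum1dep_card.
under [RHS]eq_bigr do rewrite -sum1dep_card.
rewrite (exchange_big_dep xpredT) //= [RHS](exchange_big_dep xpredT) //=.
apply: eq_bigr => x _.
rewrite (reindex_onto (fun D : {set S} => D :\ x) (fun D => x |: D)) /=.
  apply: eq_bigl => B; rewrite !inE eqxx /=.
  apply/andP/andP => [[PB /eqP BE]|[xB PB]].
    by move: PB; rewrite BE -BE setU11.
  by rewrite setD1K // eqxx.
by move=> B /andP[xB _]; rewrite setU1K.
Qed.

(* A door is a dominant pair [(A, J)] with [#|J| = #|A|.+1]; crossing it means
   adding a point to [A] or removing an index from [J], which leads to a room.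
   If no room satisfied [c @: A = J], each room would have an even number of
   nearly rainbow doors, whereas each such door leads to an even number of rooms
   except [(set0, [set i0])], which leads to exactly one. *)
Lemma scarf (x0 : X) : exists A J, dominant A J /\ c @: A = J.
Proof.
pose Q A J := dominant A J && (c @: A == J).
have [p /andP[dA /eqP cA]|none] := pickP (fun p => Q p.1 p.2).
  by exists p.1, p.2.
pose doors A J := #|[set x | (x \notin A) &&
    (nearly_rainbow A J && dominant (x |: A) J)]| +
  #|[set k in J | dominant A (J :\ k) && nearly_rainbow A J]|.
pose rooms A K := #|[set a in A | nearly_rainbow (A :\ a) K && dominant A K]| +
  #|[set j | (j \notin K) && (dominant A K && nearly_rainbow A (j |: K))]|.
have count : \sum_A \sum_J doors A J = \sum_A \sum_J rooms A J.
  rewrite /doors /rooms; under eq_bigr do rewrite big_split /=.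
  under [RHS]eq_bigr do rewrite big_split /=.
  rewrite !big_split /=; congr (_ + _).
    rewrite exchange_big [RHS]exchange_big; apply: eq_bigr => J _.
    exact: (sum_card_setU1 (fun A B => nearly_rainbow A J && dominant B J)).
  apply: eq_bigr => A _.
  by rewrite (sum_card_setU1 (fun J K => dominant A J && nearly_rainbow A K)).
have rooms_even A K : ~~ odd (rooms A K).
  have := none (A, K); rewrite /Q /rooms /=; case: (dominant A K) => /= [cAK|_].
    under eq_finset do rewrite andbT.
    by apply: room_even; rewrite cAK.
  under eq_finset do rewrite andbF andbF.
  under [in X in _ + X]eq_finset do rewrite andbF.
  by rewrite !eq_card0 // => ?; rewrite inE.
have odd_sum (S : finType) (f : S -> nat) (s : S) :
    (forall s', s' != s -> ~~ odd (f s')) -> odd (\sum_s' f s') = odd (f s).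
  move=> ev; rewrite (bigD1 s) //= oddD [X in _ (+) X](_ : _ = false) ?addbF //.
  by apply: negPf; apply: even_sum.
have even_rooms : ~~ odd (\sum_A \sum_J rooms A J).
  by apply: even_sum => A _; apply: even_sum.
have nearly0 J : nearly_rainbow set0 J = (J == [set i0]).
  rewrite /nearly_rainbow imset0 cards0; apply/and3P/eqP => [[i0J]|->].
    by rewrite eq_sym setD_eq0 => /subsetP JS _; apply/setP => i; rewrite inE;
      apply/idP/eqP => [/JS|->//]; rewrite inE => /eqP.
  by rewrite inE eqxx setDv cards1 eqxx.
have even_doors A J : (A, J) != (set0, [set i0]) -> ~~ odd (doors A J).
  move=> AJ; rewrite /doors.
  have [/andP[nAJ dAJ]|no] := boolP (nearly_rainbow A J && dominant A J).
    rewrite nAJ; have [A0|[a aA]] := set_0Vmem A.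
      by move: nAJ AJ; rewrite A0 nearly0 => /eqP->; rewrite eqxx.
    have /and3P[_ _ /eqP cardJ] := nAJ.
    by under [in X in _ + X]eq_finset do rewrite andbT; apply: door_even aA dAJ cardJ.
  rewrite !eq_card0 // => x; rewrite inE; apply: contraNF no.
    by move=> /and3P[_ dA ->]; apply: dominantS dA; rewrite // subD1set.
  by move=> /and3P[_ -> dA]; apply: dominantS dA; rewrite // subsetU1.
move: even_rooms; rewrite -count (odd_sum _ _ set0) => [|A A0]; last first.
  by apply: even_sum => J _; apply: even_doors; rewrite xpair_eqE (negPf A0).
rewrite (odd_sum _ _ [set i0]) => [|J Ji0]; last first.
  by apply: even_doors; rewrite xpair_eqE (negPf Ji0) andbF.
(* Dropping [i0] leaves no index, which is not dominant because [x0] exists; only the largest point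
   in the order [r i0] can be added. *)
suff -> : doors set0 [set i0] = 1 by [].
rewrite /doors nearly0 eqxx [in X in _ + X]eq_card0 ?addn0 => [|k]; last first.
  rewrite !inE; apply/negP => /and3P[/eqP-> /dominantP/(_ x0)[i]].
  by rewrite !inE andNb.
have [x _ xmax] := @arg_maxnP X x0 predT (r i0) isT.
apply/eqP/cards1P; exists x; apply/setP => y; rewrite !inE setU0 /=.
apply/dominantP/eqP => [dy|-> z].
  have [i] := dy x; rewrite inE => /eqP-> /(_ y); rewrite inE eqxx => /(_ isT) xy.
  by apply: (@r_inj i0); apply/eqP; rewrite eqn_leq xy andbT; apply: xmax.
by exists i0; rewrite ?inE // => a; rewrite inE => /eqP->; apply: xmax.
Qed.

End Colouring.

End Scarf.

(** * Scarf's theorem on the grid points of a simplex *)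

Section Simplex.
Variables n N : nat.
Local Notation grid := {ffun 'I_n.+1 -> 'I_N.+1}.
Local Notation simplex := {x : grid | \sum_i x i == N}.

(* Ties between equal coordinates are broken by enumerating the points. *)
Let coord_rank (i : 'I_n.+1) (x : simplex) : nat :=
  val x i * #|{: simplex}| + enum_rank x.

Let coord_rank_inj i : injective (coord_rank i).
Proof.
move=> x y xy; apply/enum_rank_inj/val_inj; move: (congr1 (modn^~ #|{: simplex}|) xy).
by rewrite /coord_rank !modnMDl !modn_small.
Qed.

Let coord_rank_le i x y : coord_rank i x <= coord_rank i y -> val x i <= val y i.
Proof.
move=> /(@leq_div2r #|{: simplex}|); have X0 : 0 < #|{: simplex}|.
  by apply/card_gt0P; exists x.
by rewrite /coord_rank !divnMDl // !divn_small ?ltn_ord // !addn0.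
Qed.

(** Order the grid points by each coordinate and let [m i] be the least [i]-th coordinate on the
    dominant set. By dominance no grid point exceeds [m i] for all colours [i] in [J], so these
    minima leave less than [#|J|] of the mass [N]. This bounds both the spread of the set and its
    coordinates outside [J]. *)
Lemma simplex_rainbow (c : grid -> 'I_n.+1) : exists A : {set grid},
  [/\ A != set0, forall a, a \in A -> \sum_i a i = N,
      forall a b i, a \in A -> b \in A -> a i <= b i + n.+1 &
      forall a i, a \in A -> i \notin c @: A -> a i <= n.+1].
Proof.
have sum_pad (f : 'I_n.+1 -> nat) (i0 : 'I_n.+1) : \sum_i f i <= N ->
    exists x : simplex, forall i, f i <= val x i /\ (i != i0 -> val x i = f i :> nat).
  (* The missing mass is put on the coordinate [i0]. *)
  move=> fN; pose g i := f i + (if i == i0 then N - \sum_i f i else 0).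
  have sumg : \sum_i g i = N.
    by rewrite big_split /= -big_mkcond big_pred1_eq subnKC.
  have gN i : g i < N.+1 by rewrite ltnS -[leqRHS]sumg (bigD1 i) //= leq_addr.
  pose x : grid := [ffun i => Ordinal (gN i)].
  have xP : \sum_i x i == N.
    by rewrite -[X in _ == X]sumg; apply/eqP/eq_bigr => i _; rewrite ffunE.
  exists (Sub x xP) => i; rewrite /= ffunE /= leq_addr; split=> // ii0.
  by rewrite /g (negPf ii0) addn0.
have [x0 _] : exists x : simplex, forall i, 0 <= val x i /\
    (i != ord0 -> val x i = 0 :> nat) by apply: sum_pad; rewrite big1.
have [A [J [/dominantP dA cA]]] := scarf coord_rank_inj (c \o val) ord0 x0.
have [i0 i0J _] := dA x0.
have [a0 a0A _] : exists2 a, a \in A & i0 = c (val a).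
  by move: i0J; rewrite -cA => /imsetP.
pose m i := val [arg min_(a < a0 in A) val a i] i.
have mP i : (exists2 a, a \in A & m i = val a i) /\
    forall a, a \in A -> m i <= val a i.
  by rewrite /m; case: arg_minnP => // a aA ?; split=> //; exists a.
(* Otherwise [(m i).+1] on [J] could be padded to a grid point that contradicts dominance. *)
have sum_m : N < \sum_(i in J) (m i).+1.
  rewrite ltnNge; apply/negP => mN.
  have [|x xP] := sum_pad (fun i => if i \in J then (m i).+1 else 0) i0.
    by rewrite -big_mkcond.
  have [i iJ le_x] := dA x; have [[a aA mE] _] := mP i.
  have [] := xP i; rewrite iJ mE => lt_x _.
  by have := coord_rank_le (le_x a aA); rewrite leqNgt lt_x.
have cardJ : #|J| <= n.+1 by rewrite -[leqRHS]card_ord max_card.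
have sum_mJ : N < \sum_(i in J) m i + #|J|.
  by rewrite -sum1_card -big_split /=; under eq_bigr do rewrite addn1.
have sumA (a : simplex) : \sum_i val a i = N by apply/eqP; case: a.
have sum_le (a : simplex) : a \in A -> \sum_(i in J) m i <= \sum_(i in J) val a i.
  by move=> aA; apply: leq_sum => i _; have [_] := mP i; apply.
have le_out (a : simplex) i : a \in A -> i \notin J -> val a i <= n.+1.
  move=> aA iJ; apply: leq_trans cardJ.
  have : val a i + \sum_(i in J) val a i <= N.
    rewrite -[leqRHS](sumA a) [leqRHS](bigD1 i) //= leq_add2l.
    rewrite [leqRHS](bigID (mem J)) /=; apply: leq_trans (leq_addr _ _).
    rewrite [leqLHS](eq_bigl (fun k => (k != i) && (k \in J))) // => k.
    by case: (k =P i) => [->|//]; rewrite (negPf iJ).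
  move=> /leq_ltn_trans/(_ sum_mJ); have := sum_le _ aA; lia.
exists (val @: A).
have cvalA : c @: (val @: A) = J by rewrite -cA -imset_comp.
split.
- by apply/set0Pn; exists (val a0); rewrite imset_f.
- by move=> _ /imsetP[a aA ->].
- move=> _ _ i /imsetP[a aA ->] /imsetP[b bA ->].
  have [iJ|iJ] := boolP (i \in J); last first.
    by apply: (leq_trans (le_out _ _ aA iJ)); apply: leq_addl.
  have : val a i <= m i + n.+1.
    have : val a i + \sum_(k in J | k != i) m k <= N.
      rewrite -[leqRHS](sumA a) [leqRHS](bigD1 i) //= leq_add2l.
      rewrite [leqRHS](bigID (mem J)) /=; apply: leq_trans (leq_addr _ _).
      rewrite [leqRHS](eq_bigl (fun k => (k \in J) && (k != i))) => [|k]; last first.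
        by rewrite andbC.
      by apply: leq_sum => k _; have [_] := mP k; apply.
    move=> /leq_ltn_trans/(_ sum_mJ); rewrite (bigD1 i iJ) /=.
    rewrite addnAC ltn_add2r => /ltnW; move/leq_trans; apply.
    by rewrite leq_add2l.
  by move=> /leq_trans; apply; rewrite leq_add2r; have [_] := mP i; apply.
- by move=> _ i /imsetP[a aA ->]; rewrite cvalA; apply: le_out.
Qed.

End Simplex.

Require Import Defs.

Local Open Scope classical_set_scope.
Local Open Scope ring_scope.

(** * Convex combinations and Lebesgue numbers *)

Lemma convex_set_sum (R : realType) (X : lmodType R)
    (A : set (convex_lmodType X)) n (w : 'I_n -> R) (u : 'I_n -> X) :
  convex_set A -> (forall i, 0 <= w i) -> \sum_i w i = 1 ->
  (forall i, A (u i)) -> A (\sum_i w i *: u i).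
Proof.
move=> cA; elim: n w u => [|n IH] w u w0.
  by rewrite big_ord0 => /esym/eqP; rewrite oner_eq0.
rewrite !big_ord_recl; set s := \sum_(i < n) _ => ws Au.
have s0 : 0 <= s by apply: sumr_ge0.
have w1 : w ord0 <= 1 by rewrite -ws lerDl.
(* The remaining weights are normalised by their sum, unless it vanishes and only the first term is
   left. *)
have [s_eq0|s_neq0] := eqVneq s 0.
  have wi i : w (lift ord0 i) = 0.
    have /psumr_eq0P : s = 0 by []. by apply.
  rewrite big1 => [|i _]; last by rewrite wi scale0r.
  by rewrite -[w ord0]addr0 -s_eq0 ws scale1r addr0.
have -> : \sum_(i < n) w (lift ord0 i) *: u (lift ord0 i) =
    s *: \sum_(i < n) (w (lift ord0 i) / s) *: u (lift ord0 i).
  rewrite scaler_sumr; apply: eq_bigr => i _.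
  by rewrite scalerA mulrC divfK.
have sE : s = 1 - w ord0 by rewrite -ws addrC addKr.
rewrite [X in _ + X *: _]sE.
apply/set_mem/(cA _ _ (Itv01 (w0 ord0) w1)); apply/mem_set; first exact: Au.
apply: IH => [i||i]; [|by rewrite -mulr_suml divff|exact: Au].
by rewrite divr_ge0.
Qed.

Lemma lebesgue_number (R : realType) (X : normedModType R) (C : set X)
    (L : Type) (D : set L) (P : L -> set X) :
  compact C -> C !=set0 ->
  (forall x, C x -> exists y e, [/\ D y, 0 < e & forall z, `|x - z| < e -> P y z]) ->
  exists n (y : 'I_n.+1 -> L) r, [/\ forall i, D (y i), 0 < r &
    forall x, C x -> exists i, forall z, `|x - z| < r -> P (y i) z].
Proof.
move=> cptC [x0 Cx0] loc.
have [y0 [e0 [Dy0 e00 _]]] := loc x0 Cx0.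
have /choice[g gP] : forall x, exists p : L * R, [/\ D p.1, 0 < p.2 &
    C x -> forall z, `|x - z| < p.2 -> P p.1 z].
  move=> x; have [Cx|nCx] := pselect (C x); last by exists (y0, e0).
  by have [y [e [? ? ?]]] := loc x Cx; exists (y, e).
(* Balls of half the radius: a ball of radius at most the least of these halves, centred in one of
   them, stays in the corresponding full ball. *)
move: cptC; rewrite compact_cover => /(_ _ C (fun x => ball x ((g x).2 / 2))).
case=> [x _|x Cx|s sC Cs]; first exact: ball_open.
  by exists x => //; apply: ballxx; have [_ ? _] := gP x; rewrite divr_gt0.
have [x1 x1s _] := Cs _ Cx0.
have s_gt0 : (0 < size (enum_fset s))%N
  by apply: (leq_ltn_trans (leq0n (index x1 (enum_fset s)))); rewrite index_mem.
pose t i := nth x0 (enum_fset s) i.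
have ts i : (i < size (enum_fset s))%N -> t i \in s by move=> ?; apply: mem_nth.
have [r r0 rP] : exists2 r, 0 < r & forall x, x \in enum_fset s -> r <= (g x).2 / 2.
  elim: (enum_fset s) => [|x l [r r0 rP]]; first by exists 1.
  have [_ gx0 _] := gP x.
  exists (Num.min r ((g x).2 / 2)); first by rewrite lt_min r0 divr_gt0.
  move=> z; rewrite inE => /orP[/eqP->|/rP]; first by rewrite ge_min lexx orbT.
  by move=> rz; rewrite ge_min rz.
exists (size (enum_fset s)).-1, (fun i => (g (t i)).1), r.
split=> // [i|x Cx]; first by have [] := gP (t i).
have [z zs] := Cs x Cx; rewrite -ball_normE /= => zx.
have zi : (index z (enum_fset s) < (size (enum_fset s)).-1.+1)%N.
  by rewrite prednK // index_mem.
exists (Ordinal zi) => v xv; rewrite /t /= nth_index //.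
have [_ _] := gP z; apply; first by have /set_mem := sC z zs.
rewrite [ltRHS]splitr -(subrKA x).
by apply: (le_lt_trans (ler_normD _ _)); rewrite ltrD // (lt_le_trans xv) // rP.
Qed.

(** * Compactness in finite dimension *)

Section FiniteDimension.
Context {R : realType} {X : normedModType R}.

(** A linear isomorphism [g] from row vectors is continuous and expands norms by at least a positive
    factor, so [C] is the image of a closed bounded set of row vectors. *)
Lemma finite_dimensional_compact (C : set X) :
  finite_dimensional X -> bounded_set C -> closed C -> compact C.
Proof.
move=> [n [[f linf [g fK gK]]]] bC cC.
have gD (a : R) u v : g (a *: u + v) = a *: g u + g v.
  by apply: (can_inj fK); rewrite gK linf !gK.
have gZ a u : g (a *: u) = a *: g u.
  have g0 : g 0 = 0 by rewrite -[X in g X](addNr 0) -scaleN1r gD scaleN1r addNr.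
  by have := gD a u 0; rewrite !addr0 g0 addr0.
have gE v : g v = \sum_(j < n) v ord0 j *: g (delta_mx 0 j).
  have g_add u w : g (u + w) = g u + g w by have := gD 1 u w; rewrite !scale1r.
  have g0 : g 0 = 0 by have := gZ 0 0; rewrite !scale0r.
  rewrite [in LHS](row_sum_delta v) (big_morph g g_add g0).
  by apply: eq_bigr => j _; rewrite gZ.
have gcts : continuous g.
  rewrite (_ : g = fun v => \sum_(j < n) v ord0 j *: g (delta_mx 0 j)); last exact/funext.
  apply: continuous_big => [|j _ v]; first exact: add_continuous.
  by apply: (@cvgZ _ _ _ (nbhs v)); [exact: coord_continuous|exact: cvg_cst].
(* [K] is the inverse of the minimum of the norm of [g] on the unit sphere, positive because [g] is
   injective. *)
have [K K0 fK_bound] : exists2 K, 0 < K & forall v, `|v| <= K * `|g v|.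
  have g_inj v : g v = 0 -> v = 0.
    move=> gv; have g0 : g 0 = 0 by have := gZ 0 0; rewrite !scale0r.
    by apply: (can_inj gK); rewrite gv g0.
  pose S := [set v : 'rV[R]_n | `|v| = 1].
  have [[v0 Sv0]|/set0P/negP/negPn/eqP S0] := pselect (S !=set0); last first.
    (* An empty sphere means that the space is zero, where any constant works. *)
    exists 1 => // v; have [->|v0] := eqVneq v 0; first by rewrite normr0 mul1r.
    have : S (`|v|^-1 *: v) by rewrite /S /= normrZ normfV normr_id mulVf // normr_eq0.
    by rewrite S0.
  have cptS : compact S.
    apply: bounded_closed_compact.
      by exists 1; split=> // M M1 v /= ->; apply: ltW.
    apply: (@preimage_closed _ _ (fun v : 'rV[R]_n => `|v|) [set 1]); last exact: closed_eq.
    by move=> v _; apply: norm_continuous.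
  have [||v Sv vmin] := @compact_EVT_min _ _ (fun v => `|g v|) _ _ cptS.
  - by exists v0.
  - apply: continuous_subspaceT => v.
    by apply: continuous_comp; [apply: gcts|apply: norm_continuous].
  have gv0 : 0 < `|g v|.
    rewrite normr_gt0; apply/eqP => /g_inj v_eq0; move: Sv; rewrite inE /S /= v_eq0 normr0.
    by move/esym/eqP; rewrite oner_eq0.
  exists (`|g v|^-1); first by rewrite invr_gt0.
  move=> u; have [->|u0] := eqVneq u 0; first by rewrite normr0 mulr_ge0 ?invr_ge0.
  rewrite mulrC ler_pdivlMr // -ler_pdivlMl ?normr_gt0 //.
  have := vmin (`|u|^-1 *: u); rewrite gZ normrZ normfV normr_id; apply.
  by rewrite inE /S /= normrZ normfV normr_id mulVf // normr_eq0.
have -> : C = g @` (g @^-1` C).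
  apply/seteqP; split=> [x Cx|_ [v Cv <-]//].
  by exists (f x); rewrite /= fK.
apply: continuous_compact; first exact: continuous_subspaceT.
apply: bounded_closed_compact; last first.
  by apply: preimage_closed => // v _; apply: gcts.
have [M [Mreal bM]] := bC.
exists (K * (`|M| + 1)); split; first exact: num_real.
move=> N ltN v Cv; apply: le_trans (ltW ltN).
apply: le_trans (fK_bound v) _; rewrite ler_pM2l //; apply: bM => //.
by rewrite (le_lt_trans (ler_norm M)) // ltrDl.
Qed.

End FiniteDimension.

(** * Approximate fixed points *)

Section NearFixedPoint.
Context {R : realType} {X : normedModType R}.

Lemma edist_inf_lt (A : set X) (y : X) (e : R) :
  (edist_inf A y < e%:E)%E -> exists2 u, A u & `|y - u| < e.
Proof.
move=> /ereal_inf_lt[_ [u Au <-]]; rewrite edist_normE lte_fin.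
by exists u.
Qed.

(** The common point given by almost lower semicontinuity may lie outside [C]; replacing it by a
    point of [F x] within [e / 2] repairs this. *)
Lemma almost_lsc_common_point (C : set X) (F : X -> set X) (x : X) (e : R) :
  almost_lsc C F -> correspondence C C F -> C x -> 0 < e ->
  exists y r, [/\ C y, 0 < r &
    forall z, `|x - z| < r -> C z -> exists2 u, F z u & `|y - u| < e].
Proof.
move=> alsc FC Cx e0; have e20 : 0 < e / 2 by rewrite divr_gt0.
have [U [_ /nbhs_ballP[r /= r0 rU] [y yU]]] := alsc x Cx _ e20.
rewrite -ball_normE in rU.
have Ux : U x by apply: rU => //=; rewrite subrr normr0.
have [y' Fy' yy'] := edist_inf_lt (yU x Ux).
exists y', r; split=> //; first by have [_] := FC x Cx; apply.
move=> z xz Cz; have [u Fu yu] := edist_inf_lt (yU z (rU z xz Cz)).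
exists u => //; rewrite -(subrKA y) [ltRHS]splitr.
by apply: (le_lt_trans (ler_normD _ _)); rewrite ltrD // distrC.
Qed.

Lemma almost_lsc_near_fixed_point (C : set X) (F : X -> set X) (e : R) :
  compact C -> C !=set0 -> convex_set (C : set (convex_lmodType X)) ->
  almost_lsc C F -> correspondence C C F ->
  (forall x, C x -> convex_set (F x : set (convex_lmodType X))) -> 0 < e ->
  exists x r, [/\ C x, 0 < r &
    forall z, C z -> `|x - z| < r -> exists2 u, F z u & `|z - u| < e].
Proof.
move=> cptC C0 cvxC alsc FC cvxF e0; set e3 := e / 3.
have e30 : 0 < e3 by rewrite divr_gt0.
have [n [y [r [Cy r0 yP]]]] := lebesgue_number cptC C0
  (fun x Cx => almost_lsc_common_point alsc FC Cx e30).
have [B B0 CB] : exists2 B, 0 < B & forall x, C x -> `|x| <= B.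
  have [M [_ MC]] := compact_bounded cptC.
  exists (`|M| + 1) => [|x Cx]; first by rewrite ltr_wpDl.
  by apply: MC Cx; rewrite (le_lt_trans (ler_norm M)) // ltrDl.
(* [K / N%:R] bounds the error from changing [n.+1] weights by at most [n.+1%:R / N%:R] each,
   against vectors of norm at most [2 * B]. The bound [dlt] keeps [z] within [r] of every [p b], and
   each error below [e3]. *)
pose K := n.+1%:R * n.+1%:R * (2 * B).
pose dlt := Num.min (r / 2) e3.
have dlt0 : 0 < dlt by rewrite lt_min divr_gt0.
have K0 : 0 < K by rewrite !mulr_gt0.
pose N := Num.bound (K / dlt).
have KN : K / dlt < N%:R by apply: archi_boundP; rewrite divr_ge0 ?ltW.
have N0 : 0 < N%:R :> R by apply: le_lt_trans KN; rewrite divr_ge0 ?ltW.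
have {}KN : K / N%:R < dlt by rewrite ltr_pdivrMr // mulrC -ltr_pdivrMr.
have KE : n.+1%:R / N%:R * (2 * B) *+ n.+1 = K / N%:R.
  by rewrite -[LHS]mulr_natl /K; field; rewrite gt_eqF.
pose w (a : {ffun 'I_n.+1 -> 'I_N.+1}) i : R := (a i)%:R / N%:R.
have w_ge0 a i : 0 <= w a i by rewrite divr_ge0.
have w_sum (a : {ffun 'I_n.+1 -> 'I_N.+1}) : (\sum_i a i)%N = N -> \sum_i w a i = 1.
  by move=> aN; rewrite -mulr_suml -natr_sum aN divff // gt_eqF.
pose p a := \sum_i w a i *: y i.
have Cp (a : {ffun 'I_n.+1 -> 'I_N.+1}) : (\sum_i a i)%N = N -> C (p a).
  by move=> aN; apply: convex_set_sum => //; apply: w_sum.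
(* The colour of a grid point is an index that works near [p a]; off the simplex it is
   irrelevant. *)
have /choice[c cP] : forall a : {ffun 'I_n.+1 -> 'I_N.+1}, exists i, (\sum_i a i)%N = N ->
    forall z, `|p a - z| < r -> C z -> exists2 u, F z u & `|y i - u| < e3.
  move=> a; have [/Cp/yP[i iP]|aN] := eqVneq (\sum_i a i)%N N; first by exists i.
  by exists ord0 => /eqP; rewrite (negPf aN).
have [A [/set0Pn[a aA] AN A_near A_out]] := simplex_rainbow c.
have w_out i : i \notin c @: A -> w a i <= n.+1%:R / N%:R.
  by move=> /(A_out _ _ aA) ai; rewrite ler_pM2r ?invr_gt0 // ler_nat.
have w_near b i : b \in A -> `|w b i - w a i| <= n.+1%:R / N%:R.
  move=> bA; rewrite -mulrBl normrM normfV (gtr0_norm N0) ler_pM2r ?invr_gt0 //.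
  rewrite ler_distl lerBlDr -natrD ler_nat A_near //=.
  by rewrite -natrD ler_nat A_near.
have p_near b : b \in A -> `|p b - p a| < r / 2.
  move=> bA; apply: (@lt_le_trans _ _ dlt); last by rewrite ge_min lexx.
  apply: le_lt_trans KN; rewrite -sumrB -KE -[X in _ *+ X]card_ord -sumr_const.
  apply: (le_trans (ler_norm_sum _ _ _)); apply: ler_sum => i _.
  rewrite -scalerBl normrZ; apply: ler_pM => //; first exact: w_near.
  by apply: (le_trans (CB _ (Cy i))); rewrite ler_peMl ?ler1n // ltW.
exists (p a), dlt; split=> //; first exact/Cp/AN.
move=> z Cz az.
(* For an index that is not a colour of [A] any point of [F z] will do, as its weight is small. *)
have /choice[u uP] : forall i, exists u, F z u /\ (i \in c @: A -> `|y i - u| < e3).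
  move=> i; have [/imsetP[b bA ->]|_] := boolP (i \in c @: A); last first.
    by have [[u Fu] _] := FC z Cz; exists u.
  have [|//|u Fu yu] := cP b (AN b bA) z; last by exists u.
  rewrite -(subrKA (p a)) [ltRHS]splitr.
  apply: (le_lt_trans (ler_normD _ _)); rewrite ltrD // ?p_near //.
  by apply: (lt_le_trans az); rewrite ge_min lexx.
have CF i : C (u i) by have [_] := FC z Cz; apply; have [] := uP i.
exists (\sum_i w a i *: u i).
  apply: (convex_set_sum (cvxF z Cz)) => // [|i]; first exact/w_sum/AN.
  by have [] := uP i.
rewrite -(subrKA (p a)).
have -> : e = e3 + (e3 + e3) by rewrite /e3; field.
apply: (le_lt_trans (ler_normD _ _)); apply: ltrD.
  by rewrite distrC (lt_le_trans az) // ge_min lexx orbT.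
apply: (@le_lt_trans _ _ (e3 + K / N%:R)); last first.
  by rewrite ltrD2l (lt_le_trans KN) // ge_min lexx orbT.
have e3E : e3 = \sum_i w a i * e3 by rewrite -mulr_suml w_sum ?mul1r // AN.
(* Both errors are spread over the indices: colours of [A] are charged to [w a i * e3], the other
   indices to the share of [K / N%:R]. *)
rewrite [e3 in leRHS]e3E -KE.
rewrite -[X in _ *+ X]card_ord -sumr_const -big_split -sumrB /=.
apply: (le_trans (ler_norm_sum _ _ _)); apply: ler_sum => i _.
rewrite -scalerBr normrZ ger0_norm //.
have [iA|iA] := boolP (i \in c @: A).
  have [_ /(_ iA) yu] := uP i.
  apply: ler_wpDr; first by rewrite !mulr_ge0 ?invr_ge0 // ltW.
  by rewrite ler_wpM2l // ltW.
apply: ler_wpDl; first by rewrite mulr_ge0 // ltW.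
apply: ler_pM => //; first exact: w_out.
by apply: (le_trans (ler_normB _ _)); rewrite mulr_natl mulr2n lerD ?CB.
Qed.

End NearFixedPoint.

(** * Measurable selections *)

Lemma exists_half_pow_lt (R : realType) (c e : R) :
  0 < e -> exists n, c / 2 ^+ n < e.
Proof.
move=> e0; exists (Num.bound `|c / e|).
rewrite ltr_pdivrMr ?exprn_gt0 // mulrC -ltr_pdivrMr //.
apply: (le_lt_trans (ler_norm _)); apply: (lt_trans (archi_boundP (normr_ge0 _))) => //.
by rewrite -natrX ltr_nat ltn_expl.
Qed.

Section MeasurableSelection.
Context {d : measure_display} {Omega : measurableType d}.

(** The least index works: its level sets are differences of measurable sets, and there are
    countably many of them. *)
Lemma measurable_first (P : Omega -> nat -> Prop) :
  (forall w, exists j, P w j) -> (forall j, measurable [set w | P w j]) ->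
  exists k : Omega -> nat, (forall w, P w (k w)) /\
    forall A : set nat, measurable (k @^-1` A).
Proof.
move=> exP mP.
have /choice[k kP] : forall w, exists j, P w j /\ forall i, (i < j)%N -> ~ P w i.
  move=> w; have exb : exists j, `[< P w j >] by have [j /asboolP] := exP w; exists j.
  case: (ex_minnP exb) => j /asboolP Pj jmin; exists j; split=> // i ij /asboolP/jmin.
  by rewrite leqNgt ij.
exists k; split=> [w|A]; first by have [] := kP w.
suff mk j : measurable (k @^-1` [set j]).
  rewrite (_ : _ @^-1` _ = \bigcup_(j in A) (k @^-1` [set j])).
    exact: bigcup_measurable.
  by apply/seteqP; split=> [w Aw|w [j Aj /= ->]//]; exists (k w).
rewrite (_ : _ @^-1` _ = [set w | P w j] `\` \bigcup_(i in `I_j) [set w | P w i]).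
  by apply: measurableD => //; apply: bigcup_measurable.
apply/seteqP; split=> w /=; have [Pk kmin] := kP w.
  by move=> <-; split=> // -[i /= /kmin].
case=> Pj nP; apply/eqP; rewrite eqn_leq; apply/andP; split; rewrite leqNgt.
  by apply/negP => /kmin.
by apply/negP => kj; apply: nP; exists (k w).
Qed.

Context {R : realType} {X : completeNormedModType R}.

Lemma geometric_cauchy_cvg (u : nat -> X) (c : R) :
  (forall n, `|u n - u n.+1| <= c / 2 ^+ n.+1) ->
  exists l, forall n, `|u n - l| <= c / 2 ^+ n.
Proof.
move=> u_step; have c0 : 0 <= c.
  have := le_trans (normr_ge0 _) (u_step 0%N).
  by rewrite pmulr_lge0 // invr_gt0 exprn_gt0.
have u_dist n m : `|u n - u (n + m)%N| <= c / 2 ^+ n.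
  (* This sharper bound telescopes, which lets the induction go through. *)
  suff : `|u n - u (n + m)%N| <= c / 2 ^+ n - c / 2 ^+ (n + m).
    by move/le_trans; apply; rewrite gerBl divr_ge0 // exprn_ge0.
  elim: m => [|m IH]; first by rewrite addn0 !subrr normr0.
  rewrite -(subrKA (u (n + m)%N)) addnS; apply: (le_trans (ler_normD _ _)).
  apply: (le_trans (lerD IH (u_step _))); rewrite le_eqVlt; apply/orP; left.
  by rewrite exprS; apply/eqP; field; rewrite ?expf_neq0 // lt0r_neq0.
have : cvg (u @ \oo).
  apply: cauchy_cvg; apply: cauchy_exP => e e0.
  have [n cn] := exists_half_pow_lt c e0.
  exists (u n); exists n => // m /= nm; rewrite -ball_normE /=.
  by rewrite -(subnKC nm) (le_lt_trans (u_dist _ _)).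
move/cvg_ex => [l ul]; exists l => n; apply/ler_addgt0Pr => e e0.
have [N _ /(_ (N + n)%N) lN] : \forall m \near \oo, `|l - u m| < e.
  by move/cvgrPdist_lt: ul; apply.
rewrite -(subrKA (u (n + N)%N)); apply: (le_trans (ler_normD _ _)).
rewrite lerD // addnC // distrC; apply/ltW/lN.
by rewrite /= leq_addr.
Qed.

(** The maps [e \o K n] take countably many values, come within [rho / 2 ^+ n] of [F w], and move by
    less than twice that at each step. The limit lies in [F w] by closedness, and the steps add up
    to [4 * rho]. *)
Lemma measurable_selection_near (e : nat -> X) (F : Omega -> set X)
    (k0 : Omega -> nat) (rho : R) :
  (forall U, open U -> measurable [set w | F w `&` U !=set0]) ->
  (forall w, closed (F w)) ->
  (forall w x, F w x -> forall r, 0 < r -> exists k, `|e k - x| < r) ->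
  (forall A, measurable (k0 @^-1` A)) -> 0 < rho ->
  (forall w, F w `&` ball (e (k0 w)) rho !=set0) ->
  exists f : Omega -> X, [/\ forall U, open U -> measurable (f @^-1` U),
    forall w, F w (f w) & forall w, `|e (k0 w) - f w| <= 4 * rho].
Proof.
move=> mF cF eF mk0 rho0 Fk0.
pose r n := rho / 2 ^+ n.
have r0 n : 0 < r n by rewrite divr_gt0 // exprn_gt0.
have rS n : r n = r n.+1 + r n.+1.
  by rewrite /r exprS; field; rewrite ?expf_neq0 // lt0r_neq0.
pose good n (k : Omega -> nat) := (forall A, measurable (k @^-1` A)) /\
  forall w, F w `&` ball (e (k w)) (r n) !=set0.
(* The next index is the first one that is good at the finer scale and close to the current point;
   [k0] is a default for pairs that are not good. *)
have /choice[nxt nxtP] : forall p : nat * (Omega -> nat), exists k', good p.1 p.2 ->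
    good p.1.+1 k' /\ forall w, `|e (p.2 w) - e (k' w)| < 2 * r p.1.
  move=> [n k] /=; have [[mk Fk]|] := pselect (good n k); last by exists k0.
  have [|j|k' [k'P mk']] := @measurable_first (fun w j =>
      F w `&` ball (e j) (r n.+1) !=set0 /\ `|e (k w) - e j| < 2 * r n).
  - move=> w; have [x [Fx]] := Fk w; rewrite -ball_normE /= => kx.
    have [j jx] := eF w x Fx _ (r0 n.+1).
    exists j; split; first by exists x; split=> //; rewrite -ball_normE.
    rewrite -(subrKA x) mulr2n mulrDl mul1r; apply: (le_lt_trans (ler_normD _ _)).
    by rewrite ltrD // distrC (lt_trans jx) // [ltRHS]rS ltrDl.
  - apply: measurableI; first exact/mF/ball_open.
    (* This condition depends on [w] only through [k w], so it is the preimage of a set of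
       integers. *)
    exact: (mk [set i | `|e i - e j| < 2 * r n]).
  - exists k' => _; split=> [|w]; last by have [] := k'P w.
    by split=> // w; have [] := k'P w.
pose K := fix K n := if n is m.+1 then nxt (m, K m) else k0.
have K_good n : good n (K n).
  elim: n => [|n IH]; first by split=> // w; rewrite /r expr0 divr1.
  by have [] := nxtP (n, K n) IH.
have K_step w n : `|e (K n w) - e (K n.+1 w)| <= 4 * rho / 2 ^+ n.+1.
  have [_ /(_ w)/ltW/le_trans] := nxtP (n, K n) (K_good n); apply.
  by rewrite /= (rS n) /r le_eqVlt; apply/orP; left; apply/eqP; ring.
have /choice[f fP] w := geometric_cauchy_cvg (K_step w).
exists f; split=> [U oU|w|w]; last by have := fP w 0%N; rewrite expr0 divr1.
(* The limit is in [U] exactly when, at some stage, the closed ball known to contain it is included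
   in [U]. The constant [8 * rho] below is the diameter bound of that ball at stage zero. *)
- rewrite (_ : _ @^-1` _ = \bigcup_n
      (K n @^-1` [set j | forall v, `|e j - v| <= 4 * rho / 2 ^+ n -> U v])).
    by apply: bigcupT_measurable => n; have [mK _] := K_good n.
  apply/seteqP; split=> [w Uw|w [n _ /=]]; last by apply; apply: fP.
  have /nbhs_ballP[t /= t0 tU] : nbhs (f w) U by apply: open_nbhs_nbhs.
  rewrite -ball_normE /= in tU.
  have [n nt] := exists_half_pow_lt (8 * rho) t0; exists n => // v vn; apply: tU => /=.
  rewrite -(subrKA (e (K n w))); apply: le_lt_trans nt.
  rewrite (_ : 8 * rho / 2 ^+ n = 4 * rho / 2 ^+ n + 4 * rho / 2 ^+ n); last by ring.
  by apply: (le_trans (ler_normD _ _)); rewrite lerD // distrC.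
- apply: cF => B /nbhs_ballP[t /= t0 tB]; rewrite -ball_normE /= in tB.
  (* [4 * rho] for the distance to the limit, and [rho] for the distance to [F w]. *)
  have [n nt] := exists_half_pow_lt (5 * rho) t0.
  have [_ /(_ w)[x [Fx]]] := K_good n; rewrite -ball_normE /= => xn.
  exists x; split=> //; apply: tB => /=.
  rewrite -(subrKA (e (K n w))); apply: lt_trans nt.
  rewrite (_ : 5 * rho / 2 ^+ n = 4 * rho / 2 ^+ n + r n); last by rewrite /r; ring.
  by apply: (le_lt_trans (ler_normD _ _)); rewrite ler_ltD // distrC.
Qed.

End MeasurableSelection.

(** * Dense sequences and the random fixed point *)

Lemma dense_sequence (X : topologicalType) (C : set X) :
  C !=set0 -> separable C -> exists e : nat -> X, (forall k, C (e k)) /\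
    C `<=` closure (range e).
Proof.
move=> [x0 Cx0] [D [/countable_injP[h hinj] DC CD]].
have [x1 [Dx1 _]] := CD x0 Cx0 _ filterT.
(* The default [x1] fills the indices that [h] does not reach. *)
pose e k := xget x1 [set x | D x /\ h x = k].
have De k : D (e k) by rewrite /e; case: xgetP => [? _ []|].
exists e; split=> [k|]; first exact: DC.
apply: (subset_trans CD); apply: closureS => x Dx; exists (h x) => //.
rewrite /e; case: xgetP => [y _ [Dy hy]|/(_ x)[]//].
by apply: hinj => //; apply/mem_set.
Qed.

Theorem theorem4 (R : realType) (d : measure_display) (Omega : measurableType d)
    (X : completeNormedModType R) (hX : finite_dimensional X)
    (C : set X) (C_nonempty : C !=set0) (C_closed : closed C)
    (C_convex : convex_set (C : set (convex_lmodType X)))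
    (C_bounded : bounded_set C) (C_separable : separable C)
    (T : Omega -> X -> set X)
    (T_random : random_operator C T) (T_M : condition_M C T)
    (T_alsc : forall w, almost_lsc C (T w))
    (T_contractive : forall w, one_set_contractive C (T w))
    (T_nonempty : forall w x, C x -> T w x !=set0)
    (T_convex : forall w x, C x -> convex_set (T w x : set (convex_lmodType X)))
    (T_closed : forall w x, C x -> closed (T w x))
    (T_inverse : forall w, closed_inverse C (T w)) :
  exists xi : Omega -> X, random_fixed_point C T xi.
Proof.
have cptC := finite_dimensional_compact hX C_bounded C_closed.
have [T_corr T_meas] := T_random.
have [e [Ce e_dense]] := dense_sequence C_nonempty C_separable.
have e_near x r : C x -> 0 < r -> exists k, `|e k - x| < r.
  move=> /e_dense Cx r0; have [_ [[k _ <-]]] := Cx _ (nbhsx_ballx x r r0).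
  by rewrite -ball_normE /= distrC; exists k.
have open_measurable_map f : (forall w, C (f w)) ->
    (forall U, open U -> measurable (f @^-1` U)) -> @measurable_map _ _ _ Omega C f.
  move=> Cf mf; split=> //.
  apply: (@measurability _ _ _ (g_sigma_algebraType (@open X)) _ f (@open X)) => //.
  by move=> _ [U oU <-]; rewrite setTI; apply: mf.
have approx n : exists p : (Omega -> X) * (Omega -> X),
    [/\ measurable_map C p.1, measurable_map C p.2, forall w, T w (p.2 w) (p.1 w) &
      forall w, `|p.2 w - p.1 w| <= 4 * (1 / 2 ^+ n)].
  have rho0 : 0 < 1 / 2 ^+ n :> R by rewrite divr_gt0 // exprn_gt0.
  (* For a fixed index [k] the condition involves [T] at the single point [e k], so it is measurable
     in [w]. *)
  have [w|j|k0 [k0P mk0]] := @measurable_first _ _ (fun w k =>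
      T w (e k) `&` (C `&` ball (e k) (1 / 2 ^+ n)) !=set0).
  - have [x [r [Cx r0 xP]]] := almost_lsc_near_fixed_point cptC C_nonempty C_convex
      (T_alsc w) (T_corr w) (T_convex w) rho0.
    have [k kx] := e_near x r Cx r0.
    have [|u Tu ku] := xP (e k) (Ce k); first by rewrite distrC.
    exists k; exists u; split=> //; split; last by rewrite -ball_normE.
    by have [_] := T_corr w (e k) (Ce k); apply.
  - exact/T_meas/ball_open.
  have [|||w|f [mf Tf f_near]] := @measurable_selection_near _ _ _ _ e
    (fun w => T w (e (k0 w))) k0 _ _ _ _ mk0 rho0.
  (* On each level set of [k0] the argument of [T] is constant, and there are countably many
     levels. *)
  - move=> U oU; rewrite (_ : [set _ | _] = \bigcup_k (k0 @^-1` [set k] `&`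
        [set w | T w (e k) `&` (C `&` U) !=set0])).
      by apply: bigcupT_measurable => k; apply: measurableI; [apply: mk0|apply: T_meas].
    apply/seteqP; split=> [w [x [Tx Ux]]|w [k _ [/= -> [x [Tx [_ Ux]]]]]]; last by exists x.
    exists (k0 w) => //; split=> //; exists x; split=> //; split=> //.
    by have [_] := T_corr w _ (Ce (k0 w)); apply.
  - by move=> w; apply: T_closed.
  - move=> w x Tx r r0; apply: e_near => //.
    by have [_] := T_corr w _ (Ce (k0 w)); apply.
  - by have [x [Tx [_ bx]]] := k0P w; exists x.
  exists (f, e \o k0); split=> //=.
    apply: open_measurable_map => // w.
    by have [_] := T_corr w _ (Ce (k0 w)); apply.
  apply: open_measurable_map => [w|U _]; first exact: Ce.
  (* All preimages under [k0] are measurable, whatever [e] is. *)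
  exact: (mk0 (e @^-1` U)).
have /choice[p pP] := approx.
apply: (T_M (fun n => (p n).1) (fun n => (p n).2)) => [n|n|n w|w];
  try by have [] := pP n.
apply/cvgr0Pnorm_lt => t t0.
have [n nt] := exists_half_pow_lt 4 t0.
exists n => // m /= nm; have [_ _ _ /(_ w)] := pP m.
move/le_lt_trans; apply; apply: le_lt_trans nt.
rewrite mulrA mulr1 ler_pM2l // lef_pV2 ?posrE ?exprn_gt0 //.
by rewrite ler_weXn2l // ler1n.
Qed.
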